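(* Let $\mathbf{W}_f,\mathbf{W}_0\in\mathbb{R}^{n\times m}$ with $i$-th rows $\mathbf{w}_f^i,\mathbf{w}_0^i\in\mathbb{R}^m$, let $\mathbf{b}_0\in\mathbb{R}^n$, and let $h_0(\mathbf{x})=\mathbf{W}_0\mathbf{x}+\mathbf{b}_0$ for $\mathbf{x}\in\mathbb{R}^m$. Equip both the input space $\mathbb{R}^m$ and the feature space $\mathbb{R}^n$ with the $\ell_\infty$ norm, and let $L_d\ge 0$. Let $\mathbf{W}_p\in\mathbb{R}^{n\times m}$ be the matrix whose $i$-th row is $$\mathbf{w}_p^i=\min\left(1,\frac{L_d}{\|\mathbf{w}_f^i-\mathbf{w}_0^i\|_1}\right)(\mathbf{w}_f^i-\mathbf{w}_0^i)+\mathbf{w}_0^i,\qquad i\in\{1,\dots,n\},$$ and let $h_p(\mathbf{x})=\mathbf{W}_p\mathbf{x}+\mathbf{b}_p$ for any $\mathbf{b}_p\in\mathbb{R}^n$. Then $h_p$ is $L_d$-Lipschitz-robust with respect to $h_0$; that is, with $\Delta h:=h_p-h_0$, $$\|\Delta h(\mathbf{x})-\Delta h(\mathbf{x}')\|_\infty\le L_d\|\mathbf{x}-\mathbf{x}'\|_\infty\quad\text{for all }\mathbf{x},\mathbf{x}'\in\mathbb{R}^m.$$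
   Context: $\mathbf{W}_0$ is the weight matrix of the pre-trained linear model, $\mathbf{W}_f$ that of the fine-tuned linear model, and $\mathbf{W}_p$ that of the projected fine-tuned model. Here $\|\cdot\|_1$ is the $\ell_1$ norm on $\mathbb{R}^m$. If $\mathbf{w}_f^i=\mathbf{w}_0^i$, the formula for $\mathbf{w}_p^i$ is understood to give $\mathbf{w}_p^i=\mathbf{w}_0^i$. A function $h$ is called $L_d$-Lipschitz-robust with respect to $h_0$ (with $L_d\ge0$) if the difference function $\Delta h=h-h_0$ satisfies $\|\Delta h(\mathbf{x})-\Delta h(\mathbf{x}')\|_{\mathrm{h}}\le L_d\|\mathbf{x}-\mathbf{x}'\|_{\mathrm{x}}$ for all $\mathbf{x},\mathbf{x}'\in\mathbb{R}^m$, where $\|\cdot\|_{\mathrm{x}}$ and $\|\cdot\|_{\mathrm{h}}$ are the chosen norms on the input and feature spaces. *)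

(* Defs.v *)
From HB Require Import structures.
From mathcomp Require Import all_boot all_order all_algebra.
From mathcomp Require Import all_classical all_reals all_analysis.

Set Implicit Arguments.
Unset Strict Implicit.
Unset Printing Implicit Defensive.

Import Order.TTheory GRing.Theory Num.Theory.
Import numFieldNormedType.Exports.
Local Open Scope ring_scope.

Definition l1_norm (R : realType) (m : nat) (v : 'rV[R]_m) : R :=
  \sum_(j < m) `|v 0 j|.

Definition linear_model (R : realType) (n m : nat)
    (W : 'M[R]_(n, m)) (b : 'cV[R]_n) (x : 'cV[R]_m) : 'cV[R]_n :=
  W *m x + b.

(* The norms are those carried by V and U; on ['cV[R]_k] the instance is
   the maximum of the absolute values of the entries, i.e. the l_infinity
   norm. *)
Definition lipschitz_robust (R : realType) (V U : normedModType R)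
    (L : R) (h h0 : V -> U) : Prop :=
  let dh : V -> U := h \- h0 in
  forall x x' : V, `|dh x - dh x'| <= L * `|x - x'|.

(* When the two i-th rows coincide the quotient is [L / 0 = 0], the scaled
   difference vanishes and the projected row is [row i W0]. *)
Definition projected_weight (R : realType) (n m : nat)
    (L : R) (W0 Wf : 'M[R]_(n, m)) : 'M[R]_(n, m) :=
  \matrix_(i < n)
    (Num.min 1 (L / l1_norm (row i Wf - row i W0)) *: (row i Wf - row i W0)
     + row i W0).

(* Main.v *)
(* The difference h_p - h_0 is affine with linear part W_p - W_0, and the
   l_infinity operator norm of a matrix is bounded by the largest l_1 norm of
   its rows; the scaling of each row of W_f - W_0 caps that norm at L_d. *)
Require Import Defs.
From HB Require Import structures.
From mathcomp Require Import all_boot all_order all_algebra.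
From mathcomp Require Import all_classical all_reals all_analysis.

Import Order.TTheory GRing.Theory Num.Theory.
Import numFieldNormedType.Exports.
Local Open Scope ring_scope.

(** The norm unfolds to a maximum over index pairs with default value 0; [0 <= c] covers that
    default. *)
Lemma mx_norm_leP (R : realType) (n m : nat) (A : 'M[R]_(n, m)) (c : R) :
  0 <= c -> reflect (forall i j, `|A i j| <= c) (`|A| <= c).
Proof.
move=> c_ge0; rewrite [`|A|]/Num.norm /= mx_normrE.
apply: (iffP (bigmax_leP _ _ _ _)) => [[_ le_c] i j|le_c].
  exact: (le_c (i, j)).
by split=> // -[i j] _; apply: le_c.
Qed.

Lemma l1_norm_ge0 (R : realType) (m : nat) (v : 'rV[R]_m) : 0 <= l1_norm v.
Proof. exact: sumr_ge0. Qed.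

Lemma l1_normZ (R : realType) (m : nat) (a : R) (v : 'rV[R]_m) :
  l1_norm (a *: v) = `|a| * l1_norm v.
Proof.
by rewrite /l1_norm mulr_sumr; apply: eq_bigr => j _; rewrite mxE normrM.
Qed.

Lemma norm_mulmx_le (R : realType) (n m : nat) (A : 'M[R]_(n, m))
    (x : 'cV[R]_m) (L : R) :
  0 <= L -> (forall i, l1_norm (row i A) <= L) -> `|A *m x| <= L * `|x|.
Proof.
move=> L_ge0 rowA; apply/mx_norm_leP => [|i k]; first exact: mulr_ge0.
(* Passing from [L] to the norm of row [i] leaves Hölder's inequality for that row, which holds term
   by term after the triangle inequality. *)
apply: (le_trans _ (ler_wpM2r (normr_ge0 x) (rowA i))).
rewrite mxE (le_trans (ler_norm_sum _ _ _)) // /l1_norm mulr_suml.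
apply: ler_sum => j _; rewrite normrM mxE ler_wpM2l //.
exact: (mx_norm_leP _ _ _ _ _ (normr_ge0 x) (lexx _)).
Qed.

Lemma l1_norm_capped (R : realType) (m : nat) (L : R) (v : 'rV[R]_m) :
  0 <= L -> l1_norm (Num.min 1 (L / l1_norm v) *: v) <= L.
Proof.
move=> L_ge0; have v_ge0 := l1_norm_ge0 _ _ v.
rewrite l1_normZ ger0_norm ?le_min ?ler01 ?divr_ge0 //.
have [->|v_neq0] := eqVneq (l1_norm v) 0; first by rewrite mulr0.
(* Dividing by the positive norm leaves the second argument of the minimum as the bound. *)
by rewrite -ler_pdivlMr ?lt0r ?v_neq0 // ge_min lexx orbT.
Qed.

(** Both biases occur at each of the two inputs, so they cancel; this is why [bp] may be
    arbitrary. *)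
Lemma subr_affine (V : zmodType) (x y x' y' p q : V) :
  x + p - (y + q) - (x' + p - (y' + q)) = x - y - (x' - y').
Proof.
have affine_sub (a b : V) : a + p - (b + q) = a - b + (p - q).
  by rewrite opprD addrACA.
by rewrite !affine_sub opprD addrACA subrr addr0.
Qed.

Theorem lemma2 (R : realType) (n m : nat) (Wf W0 : 'M[R]_(n, m))
    (b0 bp : 'cV[R]_n) (Ld : R) (Ld_ge0 : 0 <= Ld) :
  lipschitz_robust Ld
    (linear_model (projected_weight Ld W0 Wf) bp)
    (linear_model W0 b0).
Proof.
move=> x x' /=; rewrite /linear_model.
rewrite subr_affine -!mulmxBl -mulmxBr.
apply: norm_mulmx_le => // i.
(* Subtracting row [i] of [W0] undoes the shift in the projection and leaves only the capped
   difference. *)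
by rewrite linearB /= rowK addrK l1_norm_capped.
Qed.
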